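(* For each penalty type $\tau\in\{\mathit{sta},\mathit{dyn}\}$ there exists an instance of the permissive controller synthesis problem with penalty type $\tau$ (a stochastic game $\mathcal G$, a property $\phi$, a penalty scheme $(\psi,\tau)$ and a threshold $c\in\mathbb{Q}_{\ge 0}$) such that there is no deterministic multi-strategy that is sound for $\phi$ and has penalty at most $c$, but there is a randomised multi-strategy that is sound for $\phi$ and has penalty at most $c$.
   Context: A (turn-based) stochastic game is a tuple $\mathcal{G}=\langle S_\Diamond,S_\Box,\overline{s},A,\delta\rangle$, where $S=S_\Diamond\cup S_\Box$ is a finite set of states partitioned into controller states $S_\Diamond$ and environment states $S_\Box$, $\overline{s}\in S$ is the initial state, $A$ is a finite set of actions, and $\delta:S\times A\to\mathrm{Dist}(S)$ is a partial function whose distributions have rational probabilities; $A(s)=\{a\in A\mid \delta(s,a)\text{ is defined}\}$. An MDP is a game in which $S_\Diamond$ or $S_\Box$ is empty. All strategies are memoryless: a strategy for player $\Diamond$ (resp. $\Box$) is a map $\sigma:S_\Diamond\to\mathrm{Dist}(A)$ (resp. $\pi:S_\Box\to\mathrm{Dist}(A)$) with $\sigma(s)$ supported on $A(s)$; a pair $(\sigma,\pi)$ and a state $s$ induce the standard probability measure $\Pr^{\sigma,\pi}_{\mathcal G,s}$ on infinite paths $s_0a_0s_1a_1\dots$ starting at $s$. A reward structure is a function $r:S\times A\to\mathbb{Q}_{\ge 0}$, and $E^{\sigma,\pi}_{\mathcal G,s}(r)$ denotes the expectation of $\sum_{j\ge 0}r(s_j,a_j)$ under $\Pr^{\sigma,\pi}_{\mathcal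 G,s}$; it is assumed that $\sup_{\sigma,\pi}E^{\sigma,\pi}_{\mathcal G,s}(r)<\infty$ for all $s$. A property is either $\mathtt{R}^r_{\bowtie b}[\mathtt{C}]$ with $\bowtie\in\{\le,\ge\}$, $b\in\mathbb{Q}$, satisfied under $(\sigma,\pi)$ iff $E^{\sigma,\pi}_{\mathcal G,\overline s}(r)\bowtie b$, or $\mathtt{P}_{\bowtie p}[\mathtt{F}\,g]$ with $g\subseteq S$, satisfied iff the probability of reaching $g$ from $\overline s$ under $(\sigma,\pi)$ is $\bowtie p$. A strategy $\sigma$ of $\Diamond$ is sound for $\phi$ if $\phi$ is satisfied under $(\sigma,\pi)$ for every strategy $\pi$ of $\Box$. A multi-strategy is a map $\theta:S_\Diamond\to\mathrm{Dist}(2^{A})$ with $\theta(s)(\emptyset)=0$ (the sets chosen at $s$ are subsets of $A(s)$); it is deterministic if every $\theta(s)$ is a Dirac distribution, and randomised in general. A strategy $\sigma$ complies with $\theta$ ($\sigma\triangleleft\theta$) if for every $s\in S_\Diamond$ and nonempty $B\subseteq A(s)$ there is $d_{s,B}\in\mathrm{Dist}(B)$ such that $\sigma(s)(a)=\sum_{B\ni a}\theta(s)(B)\,d_{s,B}(a)$ for all $a\in A(s)$. $\theta$ is sound for $\phi$ if every $\sigma\triangleleft\theta$ is sound for $\phi$. A penalty scheme is a pair $(\psi,\tau)$ with $\psi:S_\Diamond\times A\to\mathbb{Q}_{\ge0}$ and $\tau\in\{\mathit{sta},\mathit{dyn}\}$. The local penalty is $\mathit{pen}_{loc}(\theta,s)=\sum_{B\subseteq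 A(s)}\sum_{a\in A(s)\setminus B}\theta(s)(B)\psi(s,a)$. The static penalty is $\mathit{pen}_{sta}(\theta)=\sum_{s\in S_\Diamond}\mathit{pen}_{loc}(\theta,s)$. For the dynamic penalty, let $r_\theta(s,a)=\mathit{pen}_{loc}(\theta,s)$ for $s\in S_\Diamond$, $a\in A(s)$ and $r_\theta(s,a)=0$ for $s\in S_\Box$; then $\mathit{pen}_{dyn}(\theta)=\sup\{E^{\sigma,\pi}_{\mathcal G,\overline s}(r_\theta)\mid \sigma\triangleleft\theta,\ \pi\}$ (possibly $\infty$). The permissive controller synthesis problem: given $\mathcal G$, a class $\star\in\{\mathit{det},\mathit{rand}\}$ of multi-strategies, a property $\phi$, a penalty scheme $(\psi,\tau)$ and $c\in\mathbb{Q}_{\ge0}$, decide whether there is a multi-strategy of class $\star$ that is sound for $\phi$ and has penalty $\mathit{pen}_\tau(\theta)\le c$. *)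

(* Defs.v *)
From HB Require Import structures.
From mathcomp Require Import all_boot all_order all_algebra.
From mathcomp Require Import all_classical all_reals all_analysis.

Set Implicit Arguments.
Unset Strict Implicit.
Unset Printing Implicit Defensive.
Import Order.TTheory GRing.Theory Num.Theory.
Import numFieldNormedType.Exports.

Local Open Scope classical_set_scope.
Local Open Scope ring_scope.

Record dist (R : numDomainType) (T : finType) := Dist {
  dist_fun :> T -> R;
  dist_ge0 : forall x, 0 <= dist_fun x;
  dist_sum1 : \sum_x dist_fun x = 1 }.

Definition supported_on (R : numDomainType) (T : finType)
    (d : dist R T) (B : {set T}) : Prop :=
  forall x, d x != 0 -> x \in B.

Definition is_dirac (R : numDomainType) (T : finType) (d : dist R T) : Prop :=
  exists x, forall y, d y = (y == x)%:R.

(* The disjoint sum [ctrl + env] is the partition of the states into those of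
   the controller and those of the environment. *)
Record game := Game {
  ctrl : finType;
  env : finType;
  act : finType;
  init : ctrl + env;
  trans : ctrl + env -> act -> option (dist rat (ctrl + env)%type);
  no_deadlock : forall s, exists a, trans s a }.

Definition state (G : game) : finType := (ctrl G + env G)%type.

Definition enabled (G : game) (s : state G) : {set act G} :=
  finset (fun a => isSome (trans s a)).

Record ctrl_strategy (R : realType) (G : game) := CtrlStrategy {
  ctrl_choice :> ctrl G -> dist R (act G);
  ctrl_choiceP : forall s, supported_on (ctrl_choice s) (enabled (inl s)) }.

Record env_strategy (R : realType) (G : game) := EnvStrategy {
  env_choice :> env G -> dist R (act G);
  env_choiceP : forall s, supported_on (env_choice s) (enabled (inr s)) }.

Definition choice_at (R : realType) (G : game) (sigma : ctrl_strategy R G)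
    (pi : env_strategy R G) (s : state G) : dist R (act G) :=
  match s with inl s => sigma s | inr s => pi s end.

Definition trans_prob (R : realType) (G : game) (s : state G) (a : act G)
    (t : state G) : R :=
  if trans s a is Some d then ratr (d t) else 0.

(* An infinite path s_0 a_0 s_1 a_1 ... is the sequence of the pairs
   (s_j, a_j); the measurable sets are generated by the cylinders. *)
Definition step (G : game) : Type := (state G * act G)%type.

Lemma step_inhabited (G : game) : exists x : step G, True.
Proof. by have [a _] := no_deadlock (init G); exists (init G, a). Qed.

HB.instance Definition _ (G : game) := Finite.on (step G).
HB.instance Definition _ (G : game) :=
  isPointed.Build (step G) (sval (cid (step_inhabited G))).

Definition cylinder (G : game) (w : seq (step G)) : set (nat -> step G) :=
  [set p | mkseq p (size w) = w].

Definition run (G : game) := g_sigma_algebraType (range (@cylinder G)).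
HB.instance Definition _ (G : game) := Measurable.on (run G).

Section run_measure_existence.
Variables (R : realType) (G : game) (f : seq (step G) -> R).
Hypothesis f_ge0 : forall w, 0 <= f w.
Hypothesis f_nil : f [::] = 1.
Hypothesis f_rcons : forall w, f w = \sum_x f (rcons w x).

Local Notation X := (step G).

(* The words, read backwards, are assigned nested half-open subintervals of
   [0, 1[ of length [f w]; the run of [u] is read off the intervals that
   contain [u], and the Lebesgue measure is pushed forward. *)
Let g w := f (rev w).
Let off w k := \sum_(y : X | (enum_rank y < k)%N) g (y :: w).
Fixpoint word_low (w : seq X) : R :=
  if w is x :: w' then word_low w' + off w' (enum_rank x) else 0.
Let inI u w := (word_low w <= u) && (u < word_low w + g w).

Let g_ge0 w : 0 <= g w. Proof. exact: f_ge0. Qed.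

Let off_card w : off w #|{: X}| = g w.
Proof.
rewrite /off /g f_rcons; apply: eq_big => [x|x _]; first by rewrite ltn_ord.
by rewrite rev_cons.
Qed.

Let offS w x : off w (enum_rank x).+1 = off w (enum_rank x) + g (x :: w).
Proof.
rewrite /off (bigD1 x) //= addrC; congr (_ + _); apply: eq_bigl => y.
rewrite ltnS ltn_neqAle andbC; congr (_ && _).
by rewrite (inj_eq val_inj) (inj_eq enum_rank_inj).
Qed.

Let off_le w j k : (j <= k)%N -> off w j <= off w k.
Proof.
move=> jk; rewrite /off [leRHS](bigID (fun y => (enum_rank y < j)%N)) /=.
rewrite [X in _ <= X + _](eq_bigl (fun y => (enum_rank y < j)%N)).
  by rewrite lerDl sumr_ge0.
move=> y; rewrite andb_idl // => /leq_trans; exact.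
Qed.

Let inI_cons u w : inI u w -> exists x, inI u (x :: w).
Proof.
move=> /andP[lu ul].
have ex : exists k, u < word_low w + off w k by exists #|{: X}|; rewrite off_card.
have := ex_minnP ex; case => -[|k] uk kmin.
  by move: uk; rewrite /off big_pred0 // addr0 ltNge lu.
have kX : (k < #|{: X}|)%N by apply: kmin; rewrite off_card.
pose x := enum_val (Ordinal kX).
have xE : enum_rank x = k :> nat by rewrite /x enum_valK.
exists x; rewrite /inI /= -addrA -offS xE uk andbT leNgt.
by apply/negP => /kmin; rewrite ltnn.
Qed.

Let inI_uniq u w x y : inI u (x :: w) -> inI u (y :: w) -> x = y.
Proof.
wlog xy : x y / (enum_rank x <= enum_rank y)%N => [hw ux uy|].
  by have [h|/ltnW h] := leqP (enum_rank x) (enum_rank y);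
    [exact: hw|exact/esym/hw].
move: xy; rewrite leq_eqVlt => /orP[/eqP/val_inj/enum_rank_inj //|xy].
rewrite /inI /= -!addrA -!offS => /andP[_ ux] /andP[uy _].
have := le_lt_trans uy ux; rewrite ltrD2l ltNge => /negP[].
exact: off_le.
Qed.

Let inI_behead u w x : inI u (x :: w) -> inI u w.
Proof.
rewrite /inI /= -addrA -offS => /andP[lu ul]; apply/andP; split.
  by apply: le_trans lu; rewrite lerDl sumr_ge0.
by apply: (lt_le_trans ul); rewrite lerD2l -[leRHS]off_card off_le.
Qed.

Let next u w : X := odflt point [pick x | inI u (x :: w)].
Let word u n := iter n (fun w => next u w :: w) [::].
Let run_of u : run G := fun n => next u (word u n).

Let word_inI u n : inI u [::] -> inI u (word u n).
Proof.
move=> u01; elim: n => //= n /inI_cons [x ux].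
by rewrite /next; case: pickP => [//|/(_ x)]; rewrite ux.
Qed.

Let inI_word u w : inI u w -> word u (size w) = w.
Proof.
elim: w => //= x w IH ux; rewrite IH; last exact: inI_behead ux.
congr cons; rewrite /next; case: pickP => [y uy|/(_ x)]; last by rewrite ux.
exact: inI_uniq uy ux.
Qed.

Let wordE u n : word u n = rev (mkseq (run_of u) n).
Proof. by elim: n => //= n {2}->; rewrite mkseqS rev_rcons. Qed.

Let cylinderE u w : inI u [::] -> (cylinder w (run_of u) <-> inI u (rev w)).
Proof.
move=> u01; split => [<-|uw].
  by rewrite -wordE; exact: word_inI.
have := inI_word uw; rewrite wordE size_rev => /(congr1 rev).
by rewrite !revK.
Qed.

Let unit_itv : set R := `[0, 1[%classic.

Let inI_nil u : inI u [::] = (0 <= u < 1).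
Proof. by rewrite /inI /= /g f_nil add0r. Qed.

Let unit_run u : run G := run_of (if 0 <= u < 1 then u else 0).

Let unit_run_preimage w : unit_run @^-1` cylinder w `&` unit_itv =
  `[word_low (rev w), word_low (rev w) + f w[%classic.
Proof.
apply/seteqP; split => u /=.
  case; rewrite /unit_run /unit_itv /= !in_itv /= => + u01; rewrite u01.
  by move/cylinderE; rewrite inI_nil u01 /inI /g revK => /(_ isT).
rewrite in_itv /= => uw.
have {}uw : inI u (rev w) by rewrite /inI /g revK.
have u01 : 0 <= u < 1.
  rewrite -inI_nil; elim: (rev w) uw => // x v IH /inI_behead; exact: IH.
rewrite /unit_run /unit_itv /= in_itv /= u01; split => //.
by apply/cylinderE; rewrite ?inI_nil.
Qed.

Let measurable_unit_run : measurable_fun [set: R] unit_run.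
Proof.
apply: (@measurability _ _ R (run G) setT unit_run (range (@cylinder G))).
  by [].
move=> _ [_ [w _ <-] <-].
rewrite setTI -(setUIDK (unit_run @^-1` _) unit_itv) unit_run_preimage.
apply: measurableU => //.
have [c|nc] := pselect (cylinder w (run_of 0)).
- have -> : unit_run @^-1` cylinder w `\` unit_itv = ~` unit_itv.
    apply/seteqP; split => u /=; first by case.
    rewrite /unit_itv /= in_itv /= => u01; split => //.
    by rewrite /unit_run (negbTE (introN idP u01)).
  by apply: measurableC; exact: measurable_itv.
- have -> : unit_run @^-1` cylinder w `\` unit_itv = set0.
    rewrite -subset0 => u [] /=; rewrite /unit_itv /= in_itv /=.
    by rewrite /unit_run => + u01; rewrite (negbTE (introN idP u01)).
  exact: measurable0.
Qed.

Let measurable_unit_itv : measurable unit_itv.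
Proof. exact: measurable_itv. Qed.

Definition unit_run_measure : set (run G) -> \bar R :=
  pushforward (mrestr (@lebesgue_measure R) measurable_unit_itv) unit_run.

Let unit_run_measure_cylinder w : unit_run_measure (cylinder w) = (f w)%:E.
Proof.
rewrite /unit_run_measure /pushforward /mrestr unit_run_preimage.
rewrite lebesgue_measure_itv /= lte_fin ltrDl -EFinB addrAC subrr add0r.
by case: ltgtP (f_ge0 w) => // <-.
Qed.

Let unit_run_measure0 : unit_run_measure set0 = 0%E.
Proof. exact: measure0. Qed.

Let unit_run_measure_ge0 A : (0 <= unit_run_measure A)%E.
Proof. exact: measure_ge0. Qed.

Let unit_run_measure_sigma_additive : semi_sigma_additive unit_run_measure.
Proof. exact: measure_semi_sigma_additive. Qed.

HB.instance Definition _ := isMeasure.Build _ (run G) R unit_run_measure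
  unit_run_measure0 unit_run_measure_ge0 unit_run_measure_sigma_additive.

Let unit_run_measure_setT : unit_run_measure [set: run G] = 1%E.
Proof.
rewrite -f_nil -unit_run_measure_cylinder; congr unit_run_measure.
by apply/seteqP; split.
Qed.

HB.instance Definition _ := Measure_isProbability.Build _ (run G) R
  unit_run_measure unit_run_measure_setT.

Lemma run_measure_exists :
  exists P : probability (run G) R, forall w, P (cylinder w) = (f w)%:E.
Proof. by exists unit_run_measure. Qed.

End run_measure_existence.

(* [tail_prob x w] is the probability of continuing with the steps [w] after
   the step [x]; [word_prob s w] is that of starting in [s] with [w]. *)
Fixpoint tail_prob (R : realType) (G : game) (sigma : ctrl_strategy R G)
    (pi : env_strategy R G) (x : step G) (w : seq (step G)) : R :=
  if w is y :: w' then
    trans_prob R x.1 x.2 y.1 * choice_at sigma pi y.1 y.2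
      * tail_prob sigma pi y w'
  else 1.

Definition word_prob (R : realType) (G : game) (sigma : ctrl_strategy R G)
    (pi : env_strategy R G) (s : state G) (w : seq (step G)) : R :=
  if w is x :: w' then
    (x.1 == s)%:R * choice_at sigma pi x.1 x.2 * tail_prob sigma pi x w'
  else 1.

Section word_prob_theory.
Variables (R : realType) (G : game).
Variables (sigma : ctrl_strategy R G) (pi : env_strategy R G).

Lemma choice_at_supported (s : state G) :
  supported_on (choice_at sigma pi s) (enabled s).
Proof. by case: s => s; [exact: ctrl_choiceP|exact: env_choiceP]. Qed.

Lemma trans_prob_ge0 (s : state G) (a : act G) (t : state G) :
  0 <= trans_prob R s a t.
Proof.
by rewrite /trans_prob; case: (trans s a) => // d; rewrite ler0q dist_ge0.
Qed.

Lemma tail_prob_ge0 x w : 0 <= tail_prob sigma pi x w.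
Proof.
elim: w x => [|y w IH] x //=.
by rewrite !mulr_ge0 ?IH ?trans_prob_ge0 ?dist_ge0.
Qed.

Lemma word_prob_ge0 s w : 0 <= word_prob sigma pi s w.
Proof. by case: w => //= x w; rewrite !mulr_ge0 ?tail_prob_ge0 ?dist_ge0. Qed.

Lemma sum_step (h : state G -> R) :
  \sum_(x : step G) h x.1 * choice_at sigma pi x.1 x.2 = \sum_s h s.
Proof.
rewrite -(pair_bigA _ (fun s a => h s * choice_at sigma pi s a)) /=.
by apply: eq_bigr => s _; rewrite -mulr_sumr dist_sum1 mulr1.
Qed.

Lemma tail_prob_rcons x w : x.2 \in enabled x.1 ->
  tail_prob sigma pi x w = \sum_y tail_prob sigma pi x (rcons w y).
Proof.
elim: w x => [|z w IH] x ex /=.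
  under eq_bigr do rewrite mulr1.
  rewrite sum_step; move: ex; rewrite inE /trans_prob.
  by case: (trans _ _) => // d _; rewrite -rmorph_sum dist_sum1 rmorph1.
rewrite -mulr_sumr.
have [z0|/choice_at_supported ez] := eqVneq (choice_at sigma pi z.1 z.2) 0.
  by rewrite z0 mulr0 !mul0r.
by rewrite -IH.
Qed.

Lemma word_prob_rcons s w :
  word_prob sigma pi s w = \sum_y word_prob sigma pi s (rcons w y).
Proof.
case: w => [|x w] /=.
  under eq_bigr do rewrite mulr1.
  rewrite (sum_step (fun t => (t == s)%:R)) (bigD1 s) //= eqxx big1 ?addr0 //.
  by move=> t /negbTE ->.
rewrite -mulr_sumr.
have [x0|/choice_at_supported ex] := eqVneq (choice_at sigma pi x.1 x.2) 0.
  by rewrite x0 mulr0 !mul0r.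
by rewrite -tail_prob_rcons.
Qed.

End word_prob_theory.

Definition run_measure (R : realType) (G : game) (sigma : ctrl_strategy R G)
    (pi : env_strategy R G) (s : state G) : probability (run G) R :=
  sval (cid (run_measure_exists (word_prob_ge0 sigma pi s) erefl
    (word_prob_rcons sigma pi s))).

Lemma run_measure_cylinder (R : realType) (G : game)
    (sigma : ctrl_strategy R G) (pi : env_strategy R G) (s : state G) w :
  run_measure sigma pi s (cylinder w) = (word_prob sigma pi s w)%:E.
Proof. by rewrite /run_measure; case: cid. Qed.

Definition expected_reward (R : realType) (G : game)
    (sigma : ctrl_strategy R G) (pi : env_strategy R G) (s : state G)
    (r : state G -> act G -> R) : \bar R :=
  (\int[run_measure sigma pi s]_p \sum_(0 <= j <oo) (r (p j).1 (p j).2)%:E)%E.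

Definition reach_probability (R : realType) (G : game)
    (sigma : ctrl_strategy R G) (pi : env_strategy R G) (s : state G)
    (g : {set state G}) : \bar R :=
  run_measure sigma pi s [set p | exists j, (p j).1 \in g].

Record rewards (G : game) := Rewards {
  reward_fun :> state G -> act G -> rat;
  reward_ge0 : forall s a, 0 <= reward_fun s a }.

Definition real_rewards (R : realType) (G : game) (r : rewards G)
  (s : state G) (a : act G) : R := ratr (r s a).

Inductive bound_rel := Le | Ge.

Definition satisfies_bound (R : realType) (b : bound_rel) (x : \bar R)
    (q : rat) : Prop :=
  match b with
  | Le => (x <= (ratr q)%:E)%E
  | Ge => ((ratr q)%:E <= x)%E
  end.

Inductive property (G : game) :=
| ExpectedReward of rewards G & bound_rel & rat
| Reachability of {set state G} & bound_rel & rat.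

Definition satisfied (R : realType) (G : game) (phi : property G)
    (sigma : ctrl_strategy R G) (pi : env_strategy R G) : Prop :=
  match phi with
  | ExpectedReward r bnd b =>
    satisfies_bound bnd
      (expected_reward sigma pi (init G) (real_rewards R r)) b
  | Reachability g bnd p =>
    satisfies_bound bnd (reach_probability sigma pi (init G) g) p
  end.

(* The standing assumption on reward structures. *)
Definition finite_rewards (R : realType) (G : game) (r : rewards G) : Prop :=
  forall s, (ereal_sup [set e | exists (sigma : ctrl_strategy R G)
      (pi : env_strategy R G),
      e = expected_reward sigma pi s (real_rewards R r)] < +oo)%E.

Definition admissible (R : realType) (G : game) (phi : property G) : Prop :=
  if phi is ExpectedReward r _ _ then finite_rewards R r else True.

Definition sound_strategy (R : realType) (G : game) (phi : property G)
    (sigma : ctrl_strategy R G) : Prop :=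
  forall pi, satisfied phi sigma pi.

Record multi_strategy (R : realType) (G : game) := MultiStrategy {
  allowed :> ctrl G -> dist R {set act G};
  allowed_neq0 : forall s, allowed s finset.set0 = 0;
  allowed_enabled : forall s B, allowed s B != 0 -> B \subset enabled (inl s) }.

Definition deterministic (R : realType) (G : game)
    (theta : multi_strategy R G) : Prop :=
  forall s, is_dirac (theta s).

Definition complies (R : realType) (G : game) (sigma : ctrl_strategy R G)
    (theta : multi_strategy R G) : Prop :=
  exists d : ctrl G -> {set act G} -> dist R (act G),
    (forall s (B : {set act G}), B != finset.set0 ->
       B \subset enabled (inl s) -> supported_on (d s B) B) /\
    (forall s a, a \in enabled (inl s) ->
       sigma s a = \sum_(B : {set act G} | a \in B) theta s B * d s B a).

Definition sound (R : realType) (G : game) (phi : property G)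
    (theta : multi_strategy R G) : Prop :=
  forall sigma, complies sigma theta -> sound_strategy phi sigma.

Record penalties (G : game) := Penalties {
  penalty_fun :> ctrl G -> act G -> rat;
  penalty_ge0 : forall s a, 0 <= penalty_fun s a }.

Inductive penalty_type := sta | dyn.

Definition penalty_scheme (G : game) : Type := (penalties G * penalty_type)%type.

Definition local_penalty (R : realType) (G : game) (psi : penalties G)
    (theta : multi_strategy R G) (s : ctrl G) : R :=
  \sum_(B : {set act G} | B \subset enabled (inl s))
    \sum_(a in enabled (inl s) :\: B) theta s B * ratr (psi s a).

Definition static_penalty (R : realType) (G : game) (psi : penalties G)
    (theta : multi_strategy R G) : R :=
  \sum_(s : ctrl G) local_penalty psi theta s.

(* The action is irrelevant: a disabled action is played with probability
   zero. *)
Definition penalty_rewards (R : realType) (G : game) (psi : penalties G)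
    (theta : multi_strategy R G) (s : state G) (_ : act G) : R :=
  match s with inl s => local_penalty psi theta s | inr _ => 0 end.

Definition dynamic_penalty (R : realType) (G : game) (psi : penalties G)
    (theta : multi_strategy R G) : \bar R :=
  ereal_sup [set e | exists (sigma : ctrl_strategy R G)
    (pi : env_strategy R G), complies sigma theta /\
    e = expected_reward sigma pi (init G) (penalty_rewards psi theta)].

Definition penalty (R : realType) (G : game) (scheme : penalty_scheme G)
    (theta : multi_strategy R G) : \bar R :=
  match scheme.2 with
  | sta => (static_penalty scheme.1 theta)%:E
  | dyn => dynamic_penalty scheme.1 theta
  end.

Inductive strategy_class := det | rand.

Definition in_class (R : realType) (G : game) (k : strategy_class)
    (theta : multi_strategy R G) : Prop :=
  match k with det => deterministic theta | rand => True end.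

Definition permissive_controller_synthesis (R : realType) (G : game)
    (k : strategy_class) (phi : property G) (scheme : penalty_scheme G)
    (c : rat) : Prop :=
  exists theta : multi_strategy R G,
    [/\ in_class k theta, sound phi theta
      & (penalty scheme theta <= (ratr c)%:E)%E].

(* Main.v *)
Require Import Defs.
From mathcomp Require Import all_boot all_order all_algebra.
From mathcomp Require Import all_classical all_reals all_analysis.
From mathcomp Require Import measurable_realfun measurable_fun_approximation.
Import Order.TTheory GRing.Theory Num.Theory.
Local Open Scope ring_scope.

(* The same instance serves both penalty types: one controller state with
   actions true and false, both leading to an absorbing environment state.
   Playing true earns reward 1, blocking false costs 1, and the property asks
   for expected reward at least 1/2 with penalty at most 1/2. A deterministic
   multi-strategy that does not block false admits reward 0, while one that
   blocks it pays 1; allowing {true} and {true, false} with probability 1/2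
   each guarantees reward 1/2 at penalty 1/2. As the controller state is left
   at once, the dynamic penalty agrees with the static one. *)

(** * Expected rewards as series of visit probabilities *)

Section visits.
Variables (R : realType) (G : game).
Variables (sigma : ctrl_strategy R G) (pi : env_strategy R G) (s : state G).

Definition visit (j : nat) (x : step G) : set (run G) := [set p | p j = x].

Lemma measurable_cylinder (w : seq (step G)) :
  measurable (cylinder w : set (run G)).
Proof. by apply: sub_sigma_algebra; exists w. Qed.

(** Sorting the runs by their first [j] steps leaves finitely many cylinders, so both measurability
    and probabilities of visits reduce to those of words. *)
Lemma visit_cylinders j x :
  visit j x = \big[setU/set0]_(w : j.-tuple (step G)) cylinder (rcons w x).
Proof.
rewrite -(bigcup_seq (index_enum _) (fun w : j.-tuple _ => cylinder (rcons w x))).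
apply/seteqP; split => p.
  move=> px; exists [tuple of mkseq p j]; first by rewrite /= mem_index_enum.
  by rewrite /cylinder /= size_rcons size_mkseq mkseqS px.
move=> [w _]; rewrite /cylinder /= size_rcons mkseqS => /eqP.
by rewrite eqseq_rcons size_tuple => /andP[_ /eqP].
Qed.

Lemma measurable_visit j x : measurable (visit j x).
Proof.
rewrite visit_cylinders; apply: bigsetU_measurable => w _.
exact: measurable_cylinder.
Qed.

Lemma run_measure_visit0 x :
  run_measure sigma pi s (visit 0 x) =
    ((x.1 == s)%:R * choice_at sigma pi x.1 x.2)%:E.
Proof.
rewrite (_ : visit 0 x = cylinder [:: x]).
  by rewrite run_measure_cylinder /= mulr1.
by apply/seteqP; split => p /=; [move=> <-|case].
Qed.

Lemma run_measure_visit_eq0 j x :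
  (forall w, size w = j -> word_prob sigma pi s (rcons w x) = 0) ->
  run_measure sigma pi s (visit j x) = 0%E.
Proof.
move=> w0; rewrite visit_cylinders.
(* Measurability is carried along because [measureU0] asks for it at each union. *)
pose null (A : set (run G)) := measurable A /\ run_measure sigma pi s A = 0%E.
suff : null (\big[setU/set0]_(w : j.-tuple (step G)) cylinder (rcons w x)).
  by case.
apply: big_ind => [|A B [mA A0] [mB B0]|w _]; split.
- exact: measurable0.
- exact: measure0.
- exact: measurableU.
- by rewrite measureU0.
- exact: measurable_cylinder.
- by rewrite run_measure_cylinder w0 // size_tuple.
Qed.

(** The reward at time [j] is a finite combination of indicators of visits. As all terms are
    nonnegative, integration commutes with the series and with the finite sum. *)
Lemma expected_reward_visits (r : state G -> act G -> R) :
  (forall t a, 0 <= r t a) ->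
  expected_reward sigma pi s r =
  (\sum_(0 <= j <oo)
     \sum_(x : step G) (r x.1 x.2)%:E * run_measure sigma pi s (visit j x))%E.
Proof.
move=> r0; rewrite /expected_reward.
have rE (p : run G) j : (r (p j).1 (p j).2)%:E =
    (\sum_(x : step G) (r x.1 x.2)%:E * (\1_(visit j x) p)%:E)%E.
  rewrite (bigD1 (p j)) //= indicE mem_set //= mule1 big1 ?adde0 // => x xp.
  rewrite indicE memNset ?mule0 //= => px.
  by rewrite -px eqxx in xp.
have mV j x : measurable_fun setT (EFin \o (\1_(visit j x) : run G -> R)).
  by apply/measurable_EFinP/measurable_indicP; exact: measurable_visit.
have mr j x : measurable_fun setT
    (fun p : run G => (r x.1 x.2)%:E * (\1_(visit j x) p)%:E)%E.
  by apply: measurable_funeM; exact: mV.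
have r1 j x (p : run G) : (0 <= (r x.1 x.2)%:E * (\1_(visit j x) p)%:E)%E.
  by rewrite mule_ge0 // lee_fin.
under eq_integral do under eq_eseriesr do rewrite rE.
rewrite integral_nneseries //; last first.
- by move=> n p _; apply: sume_ge0.
- by move=> n; apply: emeasurable_sum.
apply: eq_eseriesr => j _.
rewrite ge0_integral_sum; [|exact: measurableT|exact: mr|by []].
apply: eq_bigr => x _.
rewrite ge0_integralZl_EFin; [|exact: measurableT| |exact: mV|exact: r0].
  by rewrite integral_indic ?setIT //; exact: measurable_visit.
by move=> p _; rewrite lee_fin.
Qed.

End visits.

(** * Two simple distributions and the one-shot game *)

Lemma sum_dirac (R : numDomainType) (T : finType) (x : T) :
  \sum_y (y == x)%:R = 1 :> R.
Proof.
by rewrite (bigD1 x) //= eqxx big1 ?addr0 // => y /negbTE ->.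
Qed.

Definition dirac_dist (R : numDomainType) (T : finType) (x : T) : dist R T :=
  Dist (fun y => ler0n R (y == x)) (sum_dirac R T x).

Lemma uniform2_ge0 (R : realFieldType) (T : finType) (x y z : T) :
  0 <= ((z == x)%:R + (z == y)%:R) / 2 :> R.
Proof. by rewrite divr_ge0 // addr_ge0. Qed.

Lemma uniform2_sum1 (R : realFieldType) (T : finType) (x y : T) :
  \sum_z ((z == x)%:R + (z == y)%:R) / 2 = 1 :> R.
Proof. by rewrite -mulr_suml big_split /= !sum_dirac divff. Qed.

Definition uniform2 (R : realFieldType) (T : finType) (x y : T) : dist R T :=
  Dist (uniform2_ge0 R T x y) (uniform2_sum1 R T x y).

Definition one_shot_trans (s : unit + unit) (a : bool) :
    option (dist rat (unit + unit)%type) :=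
  Some (dirac_dist rat _ (inr tt)).

Lemma one_shot_no_deadlock s : exists a, one_shot_trans s a.
Proof. by exists true. Qed.

Definition one_shot : game := Game (inl tt) one_shot_no_deadlock.

Lemma one_shot_enabled (s : state one_shot) (a : bool) : a \in enabled s.
Proof. by rewrite inE. Qed.

Definition ctrl_const (R : realType) (d : dist R bool) :
    ctrl_strategy R one_shot :=
  @CtrlStrategy R one_shot (fun=> d) (fun s a _ => one_shot_enabled (inl s) a).

Definition env_const (R : realType) (d : dist R bool) :
    env_strategy R one_shot :=
  @EnvStrategy R one_shot (fun=> d) (fun s a _ => one_shot_enabled (inr s) a).

Section one_shot_strategies.
Variables (R : realType).
Variables (sigma : ctrl_strategy R one_shot) (pi : env_strategy R one_shot).

(** No transition enters the controller state, so the last factor vanishes. *)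
Lemma tail_prob_ctrl (x y : step one_shot) w (u : unit) (a : bool) :
  tail_prob sigma pi x (rcons w (inl u, a)) = 0.
Proof.
elim: w x => [|z w IH] x /=; last by rewrite IH mulr0.
by rewrite /trans_prob /= rmorph0 !mul0r.
Qed.

(** Only time 0 contributes: later steps either sit in the environment state, where [r] is zero, or
    return to the controller state with probability zero. *)
Lemma expected_reward_one_shot (s : state one_shot)
    (r : state one_shot -> bool -> R) :
  (forall t a, 0 <= r t a) -> (forall u a, r (inr u) a = 0) ->
  expected_reward sigma pi s r = (\sum_a r s a * choice_at sigma pi s a)%:E.
Proof.
move=> r0 rE; rewrite expected_reward_visits // nneseries_recl //; last first.
  by move=> j _; apply: sume_ge0 => x _; rewrite mule_ge0 // lee_fin.
rewrite [X in (_ + X)%E]eseries0 ?adde0.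
  under eq_bigr do rewrite run_measure_visit0 -EFinM.
  rewrite sumEFin; congr EFin.
  rewrite -(pair_bigA _ (fun t a =>
    r t a * ((t == s)%:R * choice_at sigma pi t a))) /=.
  rewrite (bigD1 s) //= [X in _ + X]big1 ?addr0.
    by apply: eq_bigr => a _; rewrite eqxx mul1r.
  by move=> t /negbTE ts; rewrite big1 // => a _; rewrite ts mul0r mulr0.
move=> [//|j] _ _; apply: big1 => -[[u|u] a] _ /=; last by rewrite rE mul0e.
rewrite run_measure_visit_eq0 ?mule0 // => -[//|y w] _ /=.
by rewrite tail_prob_ctrl // mulr0.
Qed.

End one_shot_strategies.

(** * Rewards, penalties and the two synthesis claims *)

Definition true_reward (s : state one_shot) (a : bool) : rat :=
  if s is inl _ then a%:R else 0.

Lemma true_reward_ge0 s a : 0 <= true_reward s a.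
Proof. by case: s. Qed.

Definition true_rewards : rewards one_shot :=
  @Rewards one_shot true_reward true_reward_ge0.

Definition false_penalties : penalties one_shot :=
  @Penalties one_shot (fun _ (a : bool) => (~~ a)%:R) (fun _ _ => ler0n _ _).

Definition half_true : property one_shot :=
  ExpectedReward true_rewards Ge (1 / 2).

Section one_shot_synthesis.
Variable R : realType.

Lemma expected_true_reward (sigma : ctrl_strategy R one_shot) pi u :
  expected_reward sigma pi (inl u) (real_rewards R true_rewards) =
  (sigma u true)%:E.
Proof.
rewrite expected_reward_one_shot /real_rewards /=.
- by rewrite big_bool /= rmorph0 rmorph1 mul0r mul1r addr0.
- by move=> t a; rewrite ler0q true_reward_ge0.
- by move=> v a; rewrite rmorph0.
Qed.

Lemma half_true_admissible : admissible R half_true.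
Proof.
move=> s; apply: (@le_lt_trans _ _ 1%E); last by rewrite ltry.
apply: ge_ereal_sup => _ [sigma [pi ->]]; case: s => u.
  rewrite expected_true_reward lee_fin -(dist_sum1 (sigma u)) big_bool /=.
  by rewrite lerDl dist_ge0.
rewrite expected_reward_one_shot /real_rewards /=.
- by rewrite big1 ?lee_fin // => a _; rewrite rmorph0 mul0r.
- by move=> t a; rewrite ler0q true_reward_ge0.
- by move=> v a; rewrite rmorph0.
Qed.

Lemma half_trueE (sigma : ctrl_strategy R one_shot) pi :
  satisfied half_true sigma pi <-> 1 / 2 <= sigma tt true.
Proof.
rewrite /satisfied /= (expected_true_reward sigma pi tt) lee_fin.
by rewrite rmorph_div // rmorph1 rmorph_nat.
Qed.

Lemma eq_set_true (B : {set bool}) :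
  B != finset.set0 -> false \notin B -> B = [set true]%SET.
Proof.
move=> /set0Pn[[] bB] fB; last by rewrite bB in fB.
by apply/setP => -[]; rewrite !inE ?bB // (negbTE fB).
Qed.

(** Only blocking [false] costs anything, and [{true}] is the only nonempty set that omits it; the
    empty set has weight zero. *)
Lemma local_penaltyE (theta : multi_strategy R one_shot) u :
  local_penalty false_penalties theta u = theta u [set true]%SET.
Proof.
rewrite /local_penalty (bigD1 [set true]%SET) /=; last first.
  by apply/fintype.subsetP => a _; exact: one_shot_enabled.
rewrite (big_pred1 false) /=; last by move=> -[]; rewrite !inE.
rewrite rmorph1 mulr1 big1 ?addr0 // => B /andP[_ BT].
rewrite big1 // => -[]; rewrite !inE /= ?rmorph0 ?mulr0 // andbT => fB.
have [->|B0] := eqVneq B finset.set0; first by rewrite allowed_neq0 mul0r.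
by rewrite (eq_set_true _ B0 fB) eqxx in BT.
Qed.

Lemma expected_penalty (theta : multi_strategy R one_shot)
    (sigma : ctrl_strategy R one_shot) (pi : env_strategy R one_shot) :
  expected_reward sigma pi (inl tt) (penalty_rewards false_penalties theta) =
  (theta tt [set true]%SET)%:E.
Proof.
rewrite expected_reward_one_shot //=.
  by rewrite -mulr_sumr local_penaltyE dist_sum1 mulr1.
by move=> [u|u] a //=; rewrite local_penaltyE dist_ge0.
Qed.

Lemma static_penaltyE (theta : multi_strategy R one_shot) :
  static_penalty false_penalties theta = theta tt [set true]%SET.
Proof. by rewrite /static_penalty (big_pred1 tt) ?local_penaltyE // => -[]. Qed.

Lemma penalty_le tau (theta : multi_strategy R one_shot) :
  (penalty (false_penalties, tau) theta <= (theta tt [set true]%SET)%:E)%E.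
Proof.
case: tau; first by rewrite /penalty /= static_penaltyE.
apply: ge_ereal_sup => _ [sigma [pi [_ ->]]].
by rewrite expected_penalty.
Qed.

(** The complying [sigma] keeps the supremum of the dynamic penalty from ranging over the empty set,
    where it would be [-oo]. *)
Lemma penalty_ge tau (theta : multi_strategy R one_shot) sigma :
  complies sigma theta ->
  ((theta tt [set true]%SET)%:E <= penalty (false_penalties, tau) theta)%E.
Proof.
move=> st; case: tau; first by rewrite /penalty /= static_penaltyE.
apply: ereal_sup_ubound; exists sigma, (env_const R (dirac_dist R _ true)).
by rewrite expected_penalty.
Qed.

(** This turns each action allowed by a deterministic multi-strategy into a strategy against which
    soundness can be tested. *)
Lemma dirac_complies (theta : multi_strategy R one_shot) (B : {set bool}) b :
  (forall C, theta tt C = (C == B)%:R) -> b \in B ->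
  complies (ctrl_const R (dirac_dist R _ b)) theta.
Proof.
(* Compliance needs a distribution on every nonempty [C], not just on [B]; if [C] misses [b], it
   contains the other action. *)
move=> tB bB; pose pt (C : {set bool}) := if b \in C then b else ~~ b.
exists (fun _ C => dirac_dist R _ (pt C)); split.
  move=> u C C0 _ a; rewrite /= pnatr_eq0 eqb0 negbK => /eqP ->.
  rewrite /pt; case: ifPn => // bC; have [c cC] := set0Pn _ C0.
  by case: b c bC cC {bB pt} => -[] //= /negbTE ->.
move=> [] a _ /=; rewrite (bigID (pred1 B)) /= [X in _ + X]big1 ?addr0.
  have [aB|aB] := boolP (a \in B).
    rewrite (big_pred1 B) => [|C /=].
      by rewrite tB eqxx mul1r /pt bB.
    by case: eqP => [->|]; rewrite ?andbF ?aB.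
  rewrite big1 => [|C /andP[aC /eqP CB]]; last by rewrite -CB aC in aB.
  by case: eqP aB => // ->; rewrite bB.
by move=> C /andP[_ /negbTE CB]; rewrite tB CB mul0r.
Qed.

Lemma no_deterministic tau :
  ~ permissive_controller_synthesis R det half_true
      (false_penalties, tau) (1 / 2).
Proof.
move=> [theta [/= /(_ tt)[B tB] snd pen]].
have complB b := @dirac_complies theta B b tB.
have B0 : B != finset.set0.
  apply/eqP => B0; have := allowed_neq0 theta tt.
  by rewrite tB B0 eqxx => /eqP; rewrite oner_eq0.
(* Otherwise always playing [false] would comply and earn 0. *)
have fB : false \notin B.
  apply/negP => /complB /snd /(_ (env_const R (dirac_dist R _ true))).
  by rewrite half_trueE /= leNgt divr_gt0.
have BT := eq_set_true _ B0 fB.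
(* Always playing [true] complies, so the penalty is at least the weight 1 of [{true}], which
   exceeds the threshold. *)
have := complB true; rewrite BT inE => /(_ isT) /(penalty_ge tau).
move=> /le_trans /(_ pen); rewrite tB BT eqxx lee_fin.
by rewrite rmorph_div // rmorph1 rmorph_nat ler_pdivlMr // mul1r lern1.
Qed.

Definition fair_choice : dist R {set bool} :=
  uniform2 R _ [set true]%SET finset.setT.

Lemma fair_choice_neq0 : fair_choice finset.set0 = 0.
Proof.
have n (B : {set bool}) : true \in B -> (finset.set0 == B) = false.
  by move=> tB; apply/eqP => B0; rewrite -B0 inE in tB.
by rewrite /= !n ?inE // addr0 mul0r.
Qed.

Definition fair_multi_strategy : multi_strategy R one_shot :=
  @MultiStrategy R one_shot (fun=> fair_choice) (fun=> fair_choice_neq0)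
    (fun s B _ => introT fintype.subsetP (fun a _ => one_shot_enabled (inl s) a)).

(** This weight serves twice: as the penalty, and as the guaranteed probability of playing
    [true]. *)
Lemma fair_choice_true : fair_choice [set true]%SET = 1 / 2.
Proof.
rewrite /= eqxx (_ : (_ == _) = false) ?addr0 //.
by apply/eqP => /setP/(_ false); rewrite !inE.
Qed.

Lemma randomised tau :
  permissive_controller_synthesis R rand half_true
    (false_penalties, tau) (1 / 2).
Proof.
exists fair_multi_strategy; split => //; last first.
  apply: (le_trans (penalty_le tau _)).
  rewrite [fair_multi_strategy _ _]fair_choice_true.
  by rewrite rmorph_div // rmorph1 rmorph_nat.
move=> sigma [d [dsupp dE]] pi; rewrite half_trueE dE ?one_shot_enabled //.
(* When [{true}] is drawn, compliance leaves no freedom: a distribution supported on a singleton is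
   Dirac. *)
have d1 : d tt [set true]%SET true = 1.
  rewrite -(dist_sum1 (d tt [set true]%SET)) big_bool /= [X in _ + X](_ : _ = 0).
    by rewrite addr0.
  have ne : [set true]%SET != finset.set0.
    by apply/set0Pn; exists true; rewrite inE.
  have en : [set true]%SET \subset enabled (inl tt : state one_shot).
    by apply/fintype.subsetP => a _; exact: one_shot_enabled.
  by apply/eqP/negPn/negP => /(dsupp tt _ ne en); rewrite inE.
rewrite (bigD1 [set true]%SET) ?inE //= d1 mulr1.
(* The other sets containing [true] can only add to its probability, however [d] resolves them. *)
rewrite -[X in X <= _]fair_choice_true lerDl sumr_ge0 // => B _.
by rewrite mulr_ge0 // dist_ge0.
Qed.

End one_shot_synthesis.

Theorem theorem3p9 (R : realType) (tau : penalty_type) :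
  exists (G : game) (phi : property G) (psi : penalties G) (c : rat),
    [/\ admissible R phi, 0 <= c,
        ~ permissive_controller_synthesis R det phi (psi, tau) c
      & permissive_controller_synthesis R rand phi (psi, tau) c].
Proof.
exists one_shot, half_true, false_penalties, (1 / 2); split.
- exact: half_true_admissible.
- exact: divr_ge0.
- exact: no_deterministic.
- exact: randomised.
Qed.
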